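(* Let $b\geq 2$ and $\rho\geq 1$ be integers, let $\Lambda=(\lambda_1,\ldots,\lambda_\rho)$ be an integer sequence with $1\leq\lambda_1\leq\cdots\leq\lambda_\rho$, put $\lambda=\lambda_1+\cdots+\lambda_\rho$, let $T=(t_{\ell,i})_{1\leq\ell\leq\rho,\,1\leq i\leq\lambda_\ell}$ be a tuple of positive integer parameters, and let $Z=(z_{\ell,i})_{1\leq\ell\leq\rho,\,1\leq i\leq\lambda_\ell}$ be a tuple of variables. Then $\Omega_{b,T}^\Lambda(0;Z)=1$, and for integers $n\geq 0$ we have $$\Omega_{b,T}^\Lambda(bn+j;Z)=\sum_{k=0}^{\lfloor\lambda/b\rfloor}Y_{bk+j}\,\Omega_{b,T}^\Lambda(n-k;Z^T)\qquad(j=0,\ldots,b-1),$$ with the convention that $\Omega_{b,T}^\Lambda(m;Z)=0$ if $m<0$. The coefficients $Y_\nu$, $0\leq\nu\leq\lambda$, are given by $$Y_\nu=\sum z_{1,i_1}z_{2,i_2}\cdots z_{\rho,i_\rho},\qquad z_{1,0}=z_{2,0}=\cdots=z_{\rho,0}=1,$$ with the sum taken over all $i_1,i_2,\ldots,i_\rho$ with $i_1+\cdots+i_\rho=\nu$ and $0\leq i_\ell\leq\lambda_\ell$ for $\ell=1,\ldots,\rho$. In particular, $Y_0=1$, $Y_1=z_{1,1}+z_{2,1}+\cdots+z_{\rho,1}$, $Y_\lambda=z_{1,\lambda_1}z_{2,\lambda_2}\cdots z_{\rho,\lambda_\rho}$, and $Y_\mu=0$ when $\mu>\lambda$.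
   Context: The polynomials $\Omega_{b,T}^\Lambda(n;Z)$ in the $\lambda$ variables $z_{\ell,i}$ are defined by the generating function (a formal power series identity in $q$) $$\sum_{n=0}^\infty\Omega_{b,T}^\Lambda(n;Z)q^n=\prod_{j=0}^\infty\prod_{\ell=1}^\rho\left(1+z_{\ell,1}^{t_{\ell,1}^j}q^{b^j}+z_{\ell,2}^{t_{\ell,2}^j}q^{2\cdot b^j}+\cdots+z_{\ell,\lambda_\ell}^{t_{\ell,\lambda_\ell}^j}q^{\lambda_\ell\cdot b^j}\right).$$ $Z^T$ denotes the tuple $(z_{\ell,i}^{t_{\ell,i}})_{1\leq\ell\leq\rho,\,1\leq i\leq\lambda_\ell}$, i.e., $\Omega_{b,T}^\Lambda(m;Z^T)$ is obtained from $\Omega_{b,T}^\Lambda(m;Z)$ by replacing each variable $z_{\ell,i}$ by $z_{\ell,i}^{t_{\ell,i}}$. *)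

(* Defs.v *)
From HB Require Import structures.
From mathcomp Require Import all_boot all_order all_algebra.
From mathcomp Require Import mpoly.

Set Implicit Arguments.
Unset Strict Implicit.
Unset Printing Implicit Defensive.

Import GRing.Theory.
Local Open Scope ring_scope.

(* Formal power series in q over R are sequences of coefficients.             *)
(* S is the infinite product of the polynomials F_0, F_1, ... in q (written   *)
(* 'X) when each coefficient of the partial products is eventually constant,  *)
(* with the corresponding coefficient of S as its final value, i.e. the       *)
(* partial products converge to S in the q-adic topology.                     *)
Definition is_infprod (R : comNzRingType) (F : nat -> {poly R}) (S : nat -> R) :=
  forall n : nat, exists J0 : nat, forall J : nat,
    (J0 <= J)%N -> (\prod_(j < J) F j)`_n = S n.

Lemma is_infprod_unique (R : comNzRingType) (F : nat -> {poly R}) (S S' : nat -> R) :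
  is_infprod F S -> is_infprod F S' -> S =1 S'.
Proof.
move=> h h' n; have [J0 hJ0] := h n; have [J1 hJ1] := h' n.
by rewrite -(hJ0 (maxn J0 J1)) ?leq_maxl // hJ1 ?leq_maxr.
Qed.

(* Polynomials with integer coefficients in the variables z_(l, i), with      *)
(* 1 <= l <= rho and 1 <= i <= lam_l; there are lam_1 + ... + lam_rho of them. *)
(* Both indices are shifted by one: l : 'I_rho and i : 'I_(lam l) stand for   *)
(* the indices l + 1 and i + 1.                                               *)
Notation zpoly lam := {mpoly int[\sum_l lam l]}.

Definition zvar (rho : nat) (lam : 'I_rho -> nat) (l : 'I_rho) (i : 'I_(lam l)) :
    zpoly lam :=
  'X_(tagnat.Rank l i).

(* z_(l, i) for 0 <= i <= lam_l (here i is not shifted), with z_(l, 0) = 1.   *)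
Definition z0 (rho : nat) (lam : 'I_rho -> nat) (l : 'I_rho) (i : 'I_(lam l).+1) :
    zpoly lam :=
  if unlift ord0 i is Some i' then zvar i' else 1.

(* The j-th factor prod_l (1 + sum_i z_(l, i) ^ (t_(l, i) ^ j) q ^ (i b ^ j)). *)
Definition gen_factor (b rho : nat) (lam : 'I_rho -> nat)
    (T : forall l : 'I_rho, 'I_(lam l) -> nat) (j : nat) : {poly zpoly lam} :=
  \prod_(l < rho)
    (1 + \sum_(i < lam l) (zvar i ^+ (T l i ^ j)%N) *: 'X^(i.+1 * b ^ j)).

Definition one_upto (R : comNzRingType) (n : nat) (p : {poly R}) :=
  forall k, (k <= n)%N -> p`_k = (k == 0%N)%:R.

Lemma coef_mul_one_upto (R : comNzRingType) (n : nat) (p q : {poly R}) :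
  one_upto n q -> forall k, (k <= n)%N -> (p * q)`_k = p`_k.
Proof.
move=> hq k lekn; rewrite coefM big_ord_recr /= subnn hq // eqxx mulr1.
rewrite big1 ?add0r // => i _; rewrite hq; last exact: leq_trans (leq_subr _ _) lekn.
by rewrite subn_eq0 leqNgt ltn_ord mulr0.
Qed.

Lemma one_upto_prod (R : comNzRingType) (n : nat) (I : finType) (F : I -> {poly R}) :
  (forall i, one_upto n (F i)) -> one_upto n (\prod_i F i).
Proof.
move=> hF; apply: (big_ind (one_upto n)) => // [k _|p q hp hq k lekn].
  by rewrite coef1.
by rewrite (coef_mul_one_upto _ hq) // hp.
Qed.

Lemma infprod_exists (R : comNzRingType) (F : nat -> {poly R}) :
  (forall n j, (n < j)%N -> one_upto n (F j)) -> {S | is_infprod F S}.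
Proof.
move=> hF; exists (fun n => (\prod_(j < n.+1) F j)`_n) => n; exists n.+1 => J.
move=> /subnKC <-; elim: (J - _)%N => [|d IHd]; first by rewrite addn0.
rewrite addnS big_ord_recr /= -IHd.
by apply: (@coef_mul_one_upto _ n) => //; apply: hF; rewrite leq_addr.
Qed.

Lemma Omega_exists (b rho : nat) (lam : 'I_rho -> nat)
    (T : forall l : 'I_rho, 'I_(lam l) -> nat) :
  (2 <= b)%N -> {S : nat -> zpoly lam | is_infprod (gen_factor b T) S}.
Proof.
move=> hb; apply: infprod_exists => n j ltnj; apply: one_upto_prod => l k lekn.
rewrite coefD coef1 coef_sum [X in _ + X]big1 ?addr0 // => i _; rewrite coefZ coefXn.
suff /ltn_eqF -> : (k < i.+1 * b ^ j)%N by rewrite mulr0.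
apply: leq_ltn_trans lekn (ltn_trans ltnj _).
by apply: leq_trans (ltn_expl j hb) _; rewrite leq_pmull.
Qed.

(* Omega is determined by its generating function, see Omega_gen below and    *)
(* is_infprod_unique; it is extended by 0 to negative indices.                *)
Definition Omega (b rho : nat) (lam : 'I_rho -> nat)
    (T : forall l : 'I_rho, 'I_(lam l) -> nat) (hb : (2 <= b)%N) (m : int) :
    zpoly lam :=
  match m with
  | Posz n => sval (Omega_exists T hb) n
  | Negz _ => 0
  end.

Lemma Omega_gen (b rho : nat) (lam : 'I_rho -> nat)
    (T : forall l : 'I_rho, 'I_(lam l) -> nat) (hb : (2 <= b)%N) :
  is_infprod (gen_factor b T) (fun n : nat => Omega T hb n%:Z).
Proof. exact: svalP (Omega_exists T hb). Qed.

(* Z ^ T, the tuple of the z_(l, i) ^ t_(l, i).                               *)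
Definition ZT (rho : nat) (lam : 'I_rho -> nat)
    (T : forall l : 'I_rho, 'I_(lam l) -> nat) :
    (\sum_l lam l).-tuple (zpoly lam) :=
  [tuple 'X_s ^+ T (tagnat.sig1 s) (tagnat.sig2 s) | s < (\sum_l lam l)%N].

Lemma ZTE (rho : nat) (lam : 'I_rho -> nat)
    (T : forall l : 'I_rho, 'I_(lam l) -> nat) (l : 'I_rho) (i : 'I_(lam l)) :
  tnth (ZT T) (tagnat.Rank l i) = zvar i ^+ T l i.
Proof.
rewrite tnth_mktuple; congr (_ ^+ _).
by rewrite /tagnat.sig1 /tagnat.sig2 /tagnat.Rank tagnat.rankK.
Qed.

Definition Y (rho : nat) (lam : 'I_rho -> nat) (nu : nat) : zpoly lam :=
  \sum_(i : {dffun forall l : 'I_rho, 'I_(lam l).+1} | (\sum_l i l == nu)%N)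
    \prod_(l < rho) z0 (i l).

(* Main.v *)
Require Import Defs.
From HB Require Import structures.
From mathcomp Require Import all_boot all_order all_algebra.
From mathcomp Require Import mpoly.

Set Implicit Arguments.
Unset Strict Implicit.
Unset Printing Implicit Defensive.

Import GRing.Theory.
Local Open Scope ring_scope.

(* Let G_j be the j-th factor of the generating function. The coefficients    *)
(* of G_0 are the Y_nu, and G_(j+1) is obtained from G_j by substituting Z^T  *)
(* for Z and q^b for q; hence Omega(q; Z) = G_0 Omega(q^b; Z^T), and the  *)
(* recurrence is read off the coefficients of q^(bn+j).                       *)

(** The functional equation is used only through finite products: [prod_gen_factorS] splits G_0 off
    the first J+1 factors and leaves the first J factors, taken at (Z^T, q^b).
    [coef_mul_comp_polyXn] extracts the coefficient of q^(bn+j), and [is_infprod_uniform] allows one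
    J large enough for every coefficient of Omega involved. This gives a sum over k <= n; its terms
    vanish beyond n (negative index of Omega) and beyond the quotient of lambda by b ([Y_gt]), so it
    equals the sum in the theorem. *)

Lemma prod_sum_dffun (R : comNzRingType) (I : finType) (J : I -> finType)
    (F : forall i, J i -> R) :
  \prod_i \sum_(j : J i) F i j =
  \sum_(f : {dffun forall i, J i}) \prod_i F i (f i).
Proof.
(* Dependent choices become functions into a tagged sum type, where the non-dependent distributivity
   law applies. *)
rewrite (reindex (@dffun_of_fprod _ _)); last exact/onW_bij/dffun_of_fprod_bij.
transitivity (\sum_(t : fprod J) \prod_(i in I) [ffun j : J i => F i j] (t i)).
  rewrite big_fprod.
  transitivity (\prod_i \sum_(j in tagged_with J i) untag 0 [ffun j => F i j] j).
    apply: eq_bigr => i _; rewrite -(big_tag (fun i => [ffun j => F i j] : _ -> R)).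
    by apply: eq_bigr => j _; rewrite ffunE.
  rewrite (bigA_distr_big_dep _ (fun i j => untag 0 [ffun j => F i j] j)).
  by apply: eq_bigl => f; apply: eq_forallb => i.
by apply: eq_bigr => t _; apply: eq_bigr => i _; rewrite !ffunE.
Qed.

(** The second factor contributes only powers of X^b, so the indices of [p] stay in the residue
    class of j mod b. *)
Lemma coef_mul_comp_polyXn (R : comNzRingType) (b j n : nat) (p q : {poly R}) :
  (j < b)%N ->
  (p * (q \Po 'X^b))`_(b * n + j) = \sum_(k < n.+1) p`_(b * k + j) * q`_(n - k).
Proof.
move=> ltjb; elim/poly_ind: q n => [|q c IHq] n.
  by rewrite comp_poly0 mulr0 coef0 big1 // => k _; rewrite coef0 mulr0.
(* The factor X of [q * 'X] becomes X^b and lowers n by one; the constant c contributes only to the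
   term k = n. *)
rewrite comp_poly_MXaddC mulrDr mulrA coefD coefMXn coefMC.
case: n => [|n].
  by rewrite muln0 add0n ltjb big_ord1 coefD coefMX coefC /= !add0r muln0.
rewrite mulnS -addnA ltnNge leq_addr /= addKn IHq [RHS]big_ord_recr /= subnn.
rewrite coefD coefMX coefC add0r mulnS -addnA; congr (_ + _).
apply: eq_bigr => k _; rewrite subSn -1?ltnS // coefD coefMX coefC /=.
by rewrite addr0.
Qed.

Lemma coef1_prod (R : comNzRingType) (I : finType) (F : I -> {poly R}) :
  (forall i, (F i)`_0 = 1) -> (\prod_i F i)`_1 = \sum_i (F i)`_1.
Proof.
move=> F0.
elim: (index_enum I) => [|i r IHr]; first by rewrite !big_nil coef1.
rewrite !big_cons coefM big_ord_recl big_ord1 F0 mul1r /= IHr coef0_prod.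
by rewrite (eq_bigr (fun=> 1)) // big1_eq mulr1 addrC.
Qed.

(** The recurrence involves the coefficients 0, ..., n of Omega at once, so they need a common
    threshold. *)
Lemma is_infprod_uniform (R : comNzRingType) (F : nat -> {poly R}) (S : nat -> R) :
  is_infprod F S ->
  forall N, exists J0, forall J m,
    (J0 <= J)%N -> (m <= N)%N -> (\prod_(j < J) F j)`_m = S m.
Proof.
move=> FS; elim=> [|N [J0 IH]].
  by have [J0 hJ0] := FS 0%N; exists J0 => J m /hJ0 hJ; rewrite leqn0 => /eqP ->.
have [J1 hJ1] := FS N.+1; exists (maxn J0 J1) => J m; rewrite geq_max => /andP[le0 le1].
by rewrite leq_eqVlt => /predU1P[->|]; [exact: hJ1 | exact: IH].
Qed.

Section YCoefficients.

Variables (rho : nat) (lam : 'I_rho -> nat).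

Lemma z0_ord0 l : z0 (ord0 : 'I_(lam l).+1) = 1.
Proof. by rewrite /z0 unlift_none. Qed.

Lemma z0_lift l (i : 'I_(lam l)) : z0 (lift ord0 i) = zvar i.
Proof. by rewrite /z0 liftK. Qed.

Lemma coef_prod_z0 nu :
  (\prod_(l < rho) \sum_(i < (lam l).+1) z0 i *: 'X^i)`_nu = Y lam nu.
Proof.
rewrite (prod_sum_dffun (fun l (i : 'I_(lam l).+1) => z0 i *: 'X^i)).
rewrite coef_sum [RHS]big_mkcond; apply: eq_bigr => f _ /=.
rewrite scaler_prod -expr_sum coefZ coefXn eq_sym.
by case: eqP; rewrite ?mulr1 ?mulr0.
Qed.

Lemma coef0_sum_z0 (l : 'I_rho) : (\sum_(i < (lam l).+1) z0 i *: 'X^i)`_0 = 1.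
Proof.
by rewrite coef_sumMXn (big_pred1 ord0) ?z0_ord0 // => i; rewrite /= -[RHS]val_eqE.
Qed.

Lemma Y_0 : Y lam 0 = 1.
Proof.
rewrite -coef_prod_z0 coef0_prod; apply: big1 => l _; exact: coef0_sum_z0.
Qed.

Lemma Y_1 :
  (forall l : 'I_rho, (1 <= lam l)%N) ->
  Y lam 1 = \sum_(l < rho) z0 (inord 1 : 'I_(lam l).+1).
Proof.
move=> lam_ge1; rewrite -coef_prod_z0 coef1_prod => [|l]; last exact: coef0_sum_z0.
apply: eq_bigr => l _; rewrite coef_sumMXn (big_pred1 (inord 1)) // => i.
(* Here 1 <= lam l ensures that [inord 1] has value 1 rather than the default 0. *)
by rewrite /= -[RHS]val_eqE /= inordK // ltnS.
Qed.

Lemma Y_sum_lam : Y lam (\sum_l lam l)%N = \prod_(l < rho) z0 (ord_max : 'I_(lam l).+1).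
Proof.
pose fmax : {dffun forall l : 'I_rho, 'I_(lam l).+1} := [ffun l => ord_max].
rewrite /Y (big_pred1 fmax) => [|f].
  by apply: eq_bigr => l _; rewrite ffunE.
apply/idP/eqP => [/eqP sumf|->]; last first.
  by apply/eqP/eq_bigr => l _; rewrite ffunE.
apply/ffunP => l; rewrite ffunE; apply/val_inj/eqP => /=.
(* Each f l is at most lam l, so equality of the sums forces equality for every l. *)
have /leqif_sum : forall l' : 'I_rho, true ->
    (f l' <= lam l' ?= iff (val (f l') == lam l'))%N.
  by move=> l' _; apply/leqif_eq; rewrite -ltnS.
by case=> _; rewrite sumf eqxx => /esym/forallP/(_ l).
Qed.

Lemma Y_gt mu : (\sum_l lam l < mu)%N -> Y lam mu = 0.
Proof.
move=> ltmu; apply: big_pred0 => f; apply/ltn_eqF.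
by apply: leq_ltn_trans ltmu; apply: leq_sum => l _; rewrite -ltnS.
Qed.

End YCoefficients.

Section GeneratingFactors.

Variables (b rho : nat) (lam : 'I_rho -> nat).
Variable T : forall l : 'I_rho, 'I_(lam l) -> nat.

Lemma coef_gen_factor0 nu : (gen_factor b T 0)`_nu = Y lam nu.
Proof.
rewrite -coef_prod_z0; congr (nth _ (polyseq _) _); apply: eq_bigr => l _.
rewrite big_ord_recl z0_ord0 scale1r; congr (_ + _).
by apply: eq_bigr => i _; rewrite z0_lift expn0 muln1 expr1.
Qed.

(** Both exponents gain one factor: z^(t^(j+1)) = (z^t)^(t^j) and q^(i b^(j+1)) = (q^b)^(i b^j). *)
Lemma gen_factorS j :
  gen_factor b T j.+1 =
  map_poly (comp_mpoly (ZT T)) (gen_factor b T j) \Po 'X^b.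
Proof.
rewrite /gen_factor !rmorph_prod; apply: eq_bigr => l _ /=.
rewrite !rmorphD !rmorph1 !rmorph_sum; congr (_ + _); apply: eq_bigr => i _ /=.
rewrite map_polyZ /= map_polyXn comp_polyZ comp_Xn_poly -exprM rmorphXn /=.
by rewrite [in RHS]/zvar comp_mpolyXU -tnth_nth ZTE -exprM !expnS mulnCA.
Qed.

Lemma coef0_gen_factor j : (0 < b)%N -> (gen_factor b T j)`_0 = 1.
Proof.
move=> b_gt0; rewrite coef0_prod; apply: big1 => l _.
rewrite coefD coef1 coef_sum [X in _ + X]big1 ?addr0 // => i _.
by rewrite coefZ coefXn eq_sym muln_eq0 expn_eq0 /= eqn0Ngt b_gt0 mulr0.
Qed.

Lemma prod_gen_factorS J :
  \prod_(j < J.+1) gen_factor b T j =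
  gen_factor b T 0 *
  (map_poly (comp_mpoly (ZT T)) (\prod_(j < J) gen_factor b T j) \Po 'X^b).
Proof.
rewrite big_ord_recl !rmorph_prod; congr (_ * _).
by apply: eq_bigr => j _; exact: gen_factorS.
Qed.

End GeneratingFactors.

Theorem theorem4p3 (b rho : nat) (hb : (2 <= b)%N) (hrho : (1 <= rho)%N)
    (lam : 'I_rho -> nat)
    (hlam_ge1 : forall l : 'I_rho, (1 <= lam l)%N)
    (hlam_mono : forall l l' : 'I_rho, (l <= l')%N -> (lam l <= lam l')%N)
    (T : forall l : 'I_rho, 'I_(lam l) -> nat)
    (hT : forall (l : 'I_rho) (i : 'I_(lam l)), (1 <= T l i)%N) :
  [/\ Omega T hb 0 = 1,
      forall n j : nat, (j < b)%N ->
        Omega T hb (b * n + j)%N%:Z =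
        \sum_(0 <= k < ((\sum_l lam l) %/ b).+1)
          Y lam (b * k + j) * (Omega T hb (n%:Z - k%:Z) \mPo ZT T)
    & [/\ Y lam 0 = 1,
          Y lam 1 = \sum_(l < rho) z0 (inord 1 : 'I_(lam l).+1),
          Y lam (\sum_l lam l)%N = \prod_(l < rho) z0 (ord_max : 'I_(lam l).+1)
        & forall mu : nat, (\sum_l lam l < mu)%N -> Y lam mu = 0]].
Proof.
have b_gt0 : (0 < b)%N by exact: ltnW.
split.
- have [J0 /(_ _ (leqnn _)) <-] := Omega_gen T hb 0%N.
  by rewrite coef0_prod; apply: big1 => j _; apply: coef0_gen_factor.
- move=> n j ltjb.
  have [J0 hJ0] := Omega_gen T hb (b * n + j)%N.
  have [J1 hJ1] := is_infprod_uniform (Omega_gen T hb) n.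
  pose s k : zpoly lam := Y lam (b * k + j) * (Omega T hb (n%:Z - k%:Z) \mPo ZT T).
  set m := ((\sum_l lam l) %/ b)%N.
  have -> : Omega T hb (b * n + j)%N%:Z = \sum_(0 <= k < n.+1) s k.
    (* The successor pays for the factor G_0 split off next: [maxn J0 J1] factors remain, enough for
       [hJ1]. *)
    rewrite -(hJ0 (maxn J0 J1).+1) ?leqW ?leq_maxl //.
    rewrite prod_gen_factorS // coef_mul_comp_polyXn // big_mkord.
    apply: eq_bigr => k _; rewrite coef_gen_factor0 coef_map hJ1 ?leq_maxr ?leq_subr //.
    by rewrite /s subzn // -ltnS.
  have s0 k : (minn n m < k)%N -> s k = 0.
    rewrite gtn_min => /orP[ltnk|]; rewrite /s.
      suff -> : Omega T hb (n%:Z - k%:Z) = 0 by rewrite comp_mpoly0 mulr0.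
      (* For n < k the integer n - k is a [Negz], where Omega is 0 by definition. *)
      by rewrite -opprB subzn 1?ltnW //; case: (k - n)%N (subn_gt0 n k) => //; rewrite ltnk.
    rewrite /m ltn_divLR // => ltk; rewrite Y_gt ?mul0r // mulnC.
    exact: leq_trans ltk (leq_addr _ _).
  (* Both upper bounds, n and m, are compared with their minimum. *)
  have trunc N : (minn n m <= N)%N ->
      \sum_(0 <= k < N.+1) s k = \sum_(0 <= k < (minn n m).+1) s k.
    move=> leN; rewrite (big_cat_nat _ (n := (minn n m).+1)) //= [X in _ + X]big_nat_cond.
    by rewrite [X in _ + X]big1 ?addr0 // => k /andP[/andP[/s0]].
  by rewrite !trunc ?geq_minl ?geq_minr.
split.
- exact: Y_0.
- exact: Y_1.
- exact: Y_sum_lam.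
- exact: Y_gt.
Qed.
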